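(* Let $u_n$ be the number of 021-avoiding ascent sequences of length $n$ that contain no two consecutive zeros. Then $$u_n=u_0u_{n-1}+u_1u_{n-2}+\dots+u_{n-1}u_0$$ for all $n\ge 3$, with initial conditions $u_0=u_1=u_2=1$.
   Context: An ascent sequence of length $n\ge1$ is a sequence $a_1a_2\dots a_n$ of nonnegative integers with $a_1=0$ and, for each $i\ge 2$, $a_i\le 1+\#\{j\in[1,i-2]: a_j<a_{j+1}\}$; the empty sequence is the ascent sequence of length 0. A sequence avoids 021 if there are no indices $i<j<k$ with $a_i<a_k<a_j$. ''No two consecutive zeros'' means there is no $i$ with $a_i=a_{i+1}=0$. *)

(* Defs.v *)
From mathcomp Require Import all_boot.
Set Implicit Arguments.
Unset Strict Implicit.
Unset Printing Implicit Defensive.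

(* Sequences are 0-indexed: a_i is [nth 0 s i.-1]. *)

(* Number of ascents of the prefix s_0 ... s_(i-1); the pairs (j, j+1) with
   both members below i are those with j < i.-1. *)
Definition asc_before (s : seq nat) (i : nat) : nat :=
  count (fun j => nth 0 s j < nth 0 s j.+1) (iota 0 i.-1).

(* The empty sequence qualifies: [head 0 [::] = 0]. *)
Definition ascent_seq (s : seq nat) : bool :=
  (head 0 s == 0) &&
  [forall i : 'I_(size s), (0 < i) ==> (nth 0 s i <= 1 + asc_before s i)].

Definition avoids021 (s : seq nat) : bool :=
  ~~ [exists i : 'I_(size s), exists j : 'I_(size s), exists k : 'I_(size s),
       [&& i < j, j < k, nth 0 s i < nth 0 s k & nth 0 s k < nth 0 s j]].

Definition no_two_consecutive_zeros (s : seq nat) : bool :=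
  ~~ [exists i : 'I_(size s),
       [&& i.+1 < size s, nth 0 s i == 0 & nth 0 s i.+1 == 0]].

(* The entries of an ascent sequence are smaller than its length, so that
   counting among n-tuples over 'I_n in [u] below omits nothing. *)
Lemma ascent_seq_ltn_size (s : seq nat) (x : nat) :
  ascent_seq s -> x \in s -> x < size s.
Proof.
case/andP=> /eqP h0 /forallP hs /(nthP 0) [i lti <-].
have [i0|i_gt0] := posnP i.
  by move: h0 lti; rewrite i0 -nth0 => ->.
have := hs (Ordinal lti); rewrite /= i_gt0 /= => /leq_ltn_trans; apply.
apply: leq_ltn_trans lti; rewrite add1n -(ltn_predK i_gt0) ltnS.
by rewrite /asc_before /= (leq_trans (count_size _ _)) ?size_iota.
Qed.

Definition u (n : nat) : nat :=
  #|[set t : n.-tuple 'I_n |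
      let s := [seq val x | x <- t] in
      [&& ascent_seq s, avoids021 s & no_two_consecutive_zeros s]]|.

(* Main.v *)
Require Import Defs.
From mathcomp Require Import all_boot.
From mathcomp Require Import ssralg poly zify.

(** Since an ascent sequence starts with 0, it avoids 021 exactly when its
    nonzero entries increase weakly. Reading it from left to right, the letters
    that may follow depend only on the slack k = ascents - maximum and on
    whether the last letter is 0. A sequence of length at least 2 without two
    consecutive zeros starts with 01, which has slack 0. Let A_k be the
    generating function of the number of continuations from slack k after a
    positive letter. The transition rules are a linear recurrence in k, which
    gives A_(k+1) = (1 + x A_0) A_k; for k = 0 they then give a quadratic
    equation for A_0, and U = 1 + x + x^2 A_0 turns it into
    U = 1 - x^2 + x U^2. *)

(** * The defining conditions as propositions *)

Lemma ascent_seqP (s : seq nat) :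
  reflect (head 0 s = 0 /\
           forall i, 0 < i < size s -> nth 0 s i <= 1 + asc_before s i)
          (ascent_seq s).
Proof.
apply: (iffP andP) => [[/eqP h0 /forallP h]|[h0 h]]; split.
- by [].
- by move=> i /andP[i0 lti]; move: (h (Ordinal lti)); rewrite /= i0.
- exact/eqP.
- by apply/forallP => i; apply/implyP => i0; apply: h; rewrite i0 /=.
Qed.

Lemma contains021P (s : seq nat) :
  reflect (exists i j k, [/\ i < j, j < k, k < size s,
             nth 0 s i < nth 0 s k & nth 0 s k < nth 0 s j])
          (~~ avoids021 s).
Proof.
rewrite negbK; apply: (iffP existsP).
- move=> [i /existsP[j /existsP[k /and4P[ij jk ik kj]]]].
  by exists i, j, k; split.
- move=> [i [j [k [ij jk lk ik kj]]]].
  have lj := ltn_trans jk lk; have li := ltn_trans ij lj.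
  exists (Ordinal li); apply/existsP; exists (Ordinal lj).
  by apply/existsP; exists (Ordinal lk); apply/and4P.
Qed.

Lemma consecutive_zerosP (s : seq nat) :
  reflect (exists i, [/\ i.+1 < size s, nth 0 s i = 0 & nth 0 s i.+1 = 0])
          (~~ no_two_consecutive_zeros s).
Proof.
rewrite negbK; apply: (iffP existsP).
- by move=> [i /and3P[li /eqP h1 /eqP h2]]; exists i.
- move=> [i [li h1 h2]]; exists (Ordinal (ltnW li)).
  by rewrite /= li h1 h2.
Qed.

(** * Appending one letter *)

Definition ascents (s : seq nat) : nat := asc_before s (size s).

Definition maximum (s : seq nat) : nat := foldr maxn 0 s.

Definition good (s : seq nat) : bool :=
  [&& ascent_seq s, avoids021 s & no_two_consecutive_zeros s].

Lemma asc_before_rcons (s : seq nat) (x i : nat) :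
  i <= size s -> asc_before (rcons s x) i = asc_before s i.
Proof.
move=> lei; apply: eq_in_count => j; rewrite mem_iota => /andP[_ ltj].
have ltj1 : j.+1 < size s by lia.
by rewrite !nth_rcons ltj1 (ltnW ltj1).
Qed.

Lemma ascents_rcons (y : nat) (s : seq nat) (x : nat) :
  ascents (rcons (y :: s) x) = ascents (y :: s) + (last y s < x).
Proof.
rewrite /ascents size_rcons {1}/asc_before [(size _).+1.-1]/= -[(size s).+1]addn1 iotaD count_cat /= addn0.
congr (_ + _).
  exact: (asc_before_rcons (y :: s) x (size s).+1).
rewrite add0n nth_rcons ltnn eqxx -rcons_cons nth_rcons /= ltnS leqnn.
by rewrite -[nth _ _ _]/(nth 0 (y :: s) (size (y :: s)).-1) nth_last.
Qed.

Lemma ascents_lt_size (y : nat) (s : seq nat) : ascents (y :: s) < size (y :: s).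
Proof. by rewrite ltnS (leq_trans (count_size _ _)) ?size_iota. Qed.

Lemma maximum_rcons (s : seq nat) (x : nat) :
  maximum (rcons s x) = maxn (maximum s) x.
Proof. by elim: s => [|y s IHs] /=; [rewrite maxnC | rewrite IHs maxnA]. Qed.

Lemma maximum_leq (s : seq nat) (x : nat) :
  (maximum s <= x) = all (fun y => y <= x) s.
Proof. by elim: s => //= y s IHs; rewrite geq_max IHs. Qed.

Lemma ascent_seq_rcons (y : nat) (s : seq nat) (x : nat) :
  ascent_seq (rcons (y :: s) x) =
  ascent_seq (y :: s) && (x <= 1 + ascents (y :: s)).
Proof.
apply/ascent_seqP/andP => [[h0 h]|[/ascent_seqP[h0 h] hx]].
- split.
    apply/ascent_seqP; split => // i /andP[i0 lti].
    have := h i; rewrite size_rcons i0 ltnS (ltnW lti) => /(_ isT).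
    by rewrite nth_rcons lti asc_before_rcons // ltnW.
  have := h (size (y :: s)); rewrite size_rcons leqnn => /(_ isT).
  by rewrite nth_rcons ltnn eqxx asc_before_rcons.
- split => // i /andP[i0]; rewrite size_rcons ltnS => lei.
  rewrite nth_rcons asc_before_rcons //.
  case: ltngtP lei => // [lti _|-> _]; first by apply: h; rewrite i0.
  by [].
Qed.

(* The leading 0 completes any descent to a nonzero entry to a 021. *)
Lemma avoids021_rcons (s : seq nat) (x : nat) :
  avoids021 (rcons (0 :: s) x) =
  avoids021 (0 :: s) && ((x == 0) || (maximum (0 :: s) <= x)).
Proof.
apply: negb_inj; apply/idP/idP.
- move=> /contains021P[i [j [k [ij jk]]]]; rewrite size_rcons ltnS => lek.
  have ltj := leq_trans jk lek; have lti := ltn_trans ij ltj.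
  rewrite !nth_rcons lti ltj.
  rewrite negb_and; have [ltk|gek] := ltnP k (size (0 :: s)) => ik kj.
    by apply/orP; left; apply/contains021P; exists i, j, k.
  have /eqP ek : k == size (0 :: s) by rewrite eqn_leq lek gek.
  rewrite ek eqxx in ik kj.
  apply/orP; right; rewrite negb_or -lt0n (leq_ltn_trans _ ik) //=.
  rewrite -[X in ~~ (X <= _)]/(maximum (0 :: s)) maximum_leq -has_predC.
  apply/hasP; exists (nth 0 (0 :: s) j); first exact: mem_nth.
  by rewrite /= -ltnNge.
- rewrite negb_and => /orP bad; apply/contains021P; case: bad.
    move=> /contains021P[i [j [k [ij jk ltk ik kj]]]].
    exists i, j, k; rewrite size_rcons !nth_rcons ltk (ltn_trans jk ltk).
    by rewrite (ltn_trans ij (ltn_trans jk ltk)) ltnS (ltnW ltk).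
  rewrite negb_or -lt0n maximum_leq -has_predC => /andP[x0 /hasP[y ys /= ltxy]].
  rewrite -ltnNge in ltxy.
  exists 0, (index y (0 :: s)), (size (0 :: s)).
  have lt_ind : index y (0 :: s) < size (0 :: s) by rewrite index_mem.
  rewrite size_rcons -!rcons_cons !nth_rcons lt_ind nth_index // ltnn eqxx /=.
  split=> //; rewrite (_ : 0 == y = false) //.
  by apply/eqP => y0; rewrite -y0 in ltxy.
Qed.

Lemma no_two_consecutive_zeros_rcons (y : nat) (s : seq nat) (x : nat) :
  no_two_consecutive_zeros (rcons (y :: s) x) =
  no_two_consecutive_zeros (y :: s) && ~~ ((last y s == 0) && (x == 0)).
Proof.
have last_nth0 : nth 0 (y :: s) (size s) = last y s.
  by rewrite -[size s]/(size (y :: s)).-1 nth_last.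
apply: negb_inj; apply/idP/idP.
- move=> /consecutive_zerosP[i []]; rewrite size_rcons ltnS => lti.
  rewrite !nth_rcons lti => h1; rewrite negb_and negbK.
  have [lti1|gei] := ltnP i.+1 (size (y :: s)) => h2.
    by apply/orP; left; apply/consecutive_zerosP; exists i.
  have /eqP ei : i.+1 == size (y :: s) by rewrite eqn_leq lti gei.
  move: h1 h2; rewrite ei eqxx; case: ei => ->; rewrite last_nth0 => -> ->.
  by rewrite orbT.
- rewrite negb_and negbK => /orP bad; apply/consecutive_zerosP; case: bad.
    move=> /consecutive_zerosP[i [lti h1 h2]].
    by exists i; rewrite size_rcons !nth_rcons lti (ltnW lti) ltnS (ltnW lti).
  move=> /andP[/eqP h1 /eqP h2]; exists (size s).
  by rewrite size_rcons !nth_rcons /= ltnn eqxx ltnS leqnn last_nth0.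
Qed.

(** The prefix constrains the new letter only through its ascents, its maximum and its last letter,
    so these can serve as the state of a transfer recurrence. *)
Lemma good_rcons (s : seq nat) (x : nat) :
  good (rcons (0 :: s) x) =
  [&& good (0 :: s), x <= 1 + ascents (0 :: s),
      (x == 0) || (maximum (0 :: s) <= x) & ~~ ((last 0 s == 0) && (x == 0))].
Proof.
rewrite /good ascent_seq_rcons avoids021_rcons no_two_consecutive_zeros_rcons.
by rewrite (andbACA (avoids021 _)) andbACA.
Qed.

Lemma good_nil : good [::].
Proof.
apply/and3P; split.
- by apply/ascent_seqP; split=> // i; rewrite andbF.
- by apply: contraT => /contains021P[i [j [k []]]].
- by apply: contraT => /consecutive_zerosP[i []].
Qed.

Lemma good_seq1 (x : nat) : good [:: x] = (x == 0).
Proof.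
apply/and3P/eqP => [[/ascent_seqP[]]//|->]; split.
- by apply/ascent_seqP; split=> // -[|i] //=.
- by apply: contraT => /contains021P[[|i] [[|j] [[|k] []]]].
- by apply: contraT => /consecutive_zerosP[i []].
Qed.

(** * Prefixes and the number of their extensions *)

Lemma good_head (y : nat) (s : seq nat) : good (y :: s) -> y = 0.
Proof. by case/and3P=> /ascent_seqP[]. Qed.

(** Removing the letters of [t] from the end one by one loses no condition on what remains. Hence a
    bad prefix contributes nothing when extensions are counted. *)
Lemma good_catl (s t : seq nat) : good (s ++ t) -> good s.
Proof.
elim/last_ind: t => [|t x IHt]; first by rewrite cats0.
rewrite -rcons_cat; case E: (s ++ t) => [|y r].
  by case: s E {IHt} => // _ _; exact: good_nil.
move=> gr; have y0 : y = 0 by exact: good_head gr.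
by apply: IHt; rewrite E; move: gr; rewrite y0 good_rcons => /and4P[].
Qed.

(** The alphabet size [N] is separate from the number [n] of added letters, so that it stays fixed
    while [n] decreases in an induction. *)
Definition extensions (N n : nat) (s : seq nat) : nat :=
  #|[set t : n.-tuple 'I_N | good (s ++ [seq val x | x <- t])]|.

Lemma extensions0 (N : nat) (s : seq nat) : extensions N 0 s = good s.
Proof.
rewrite /extensions; case gs: (good s).
  rewrite (_ : [set _ | _] = setT) ?cardsT ?card_tuple //.
  by apply/setP => t; rewrite !inE tuple0 /= cats0.
by apply/eqP; rewrite cards_eq0; apply/eqP/setP => t; rewrite !inE tuple0 /= cats0.
Qed.

Lemma extensions_bad (N n : nat) (s : seq nat) :
  ~~ good s -> extensions N n s = 0.
Proof.
move=> bs; apply/eqP; rewrite cards_eq0; apply/eqP/setP => t; rewrite !inE.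
by apply: contraNF bs => /good_catl.
Qed.

Lemma extensionsS (N n : nat) (s : seq nat) :
  extensions N n.+1 s = \sum_(0 <= x < N) extensions N n (rcons s x).
Proof.
rewrite big_mkord /extensions -sum1dep_card.
rewrite (partition_big (@thead n _) predT) //=; apply: eq_bigr => x _.
rewrite -sum1dep_card (reindex (fun t : n.-tuple 'I_N => [tuple of x :: t])) /=.
  by apply: eq_bigl => t; rewrite theadE eqxx andbT cat_rcons.
exists (fun t : n.+1.-tuple 'I_N => [tuple of behead t]) => t.
  by move=> _; apply: val_inj.
case/tupleP: t => y t; rewrite inE theadE => /andP[_ /eqP ->].
by apply: val_inj.
Qed.

Lemma u_extensions (n : nat) : u n = extensions n n [::].
Proof. by []. Qed.

(** * Transition rules for the slack *)

(* [walks n k z] counts the extensions by n letters of a good sequence with a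
   positive entry, where [k = ascents - maximum] and [z] tells whether the last
   letter is 0. *)
Fixpoint walks (n k : nat) (z : bool) : nat :=
  if n is n'.+1 then
    if z then \sum_(j < k.+2) walks n' j false
    else walks n' k true + walks n' k false + \sum_(j < k.+1) walks n' j false
  else 1.

(** Turns a sum over the next letter into a sum over the resulting slack. The index is reversed
    because a larger letter raises the maximum and so leaves less slack. *)
Lemma sum_up_to (m k N : nat) (F G : nat -> nat) :
  m + k < N ->
  (forall d, d <= k -> F (m + d) = G (k - d)) ->
  (forall x, x < N -> (x < m) || (m + k < x) -> F x = 0) ->
  \sum_(0 <= x < N) F x = \sum_(j < k.+1) G j.
Proof.
move=> ltN FG F0.
rewrite (@big_cat_nat _ _ _ m) //=; last by lia.
rewrite big_nat big1 ?add0n; last by move=> i /andP[_ lti]; apply: F0; lia.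
rewrite (@big_cat_nat _ _ _ (m + k).+1) //=; last by lia.
rewrite [X in _ + X]big_nat [X in _ + X]big1 ?addn0; last first.
  by move=> i /andP[lti ltiN]; apply: F0; lia.
rewrite -{1}[m]add0n big_addn -addnS addKn big_nat_rev big_mkord.
apply: eq_bigr => i _; rewrite add0n addnC FG; last by lia.
by congr G; have := ltn_ord i; lia.
Qed.

Lemma extensions_walks (N n k : nat) (z : bool) (s : seq nat) :
  good (0 :: s) -> 0 < maximum (0 :: s) ->
  last 0 s = (if z then 0 else maximum (0 :: s)) ->
  ascents (0 :: s) = maximum (0 :: s) + k ->
  size (0 :: s) + n <= N ->
  extensions N n (0 :: s) = walks n k z.
Proof.
elim: n k z s => [|n IHn] k z s gs m_gt0 last_s asc_s leN.
  by rewrite extensions0 gs.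
have gx x : good (0 :: rcons s x) = [&& x <= maximum (0 :: s) + k.+1,
    (x == 0) || (maximum (0 :: s) <= x) & ~~ ((last 0 s == 0) && (x == 0))].
  by rewrite -rcons_cons good_rcons gs asc_s addnS add1n.
have mx x : maximum (0 :: rcons s x) = maxn (maximum (0 :: s)) x.
  by rewrite -rcons_cons maximum_rcons.
have ax x : ascents (0 :: rcons s x) = maximum (0 :: s) + k + (last 0 s < x).
  by rewrite -rcons_cons ascents_rcons asc_s.
have sx x : size (0 :: rcons s x) + n <= N.
  by move: leN; rewrite /= size_rcons; lia.
(* The largest admissible letter is one more than the number of ascents, hence at most the length of
   the prefix: the alphabet contains every admissible letter. *)
have ltN : maximum (0 :: s) + k.+1 < N.
  by have := ascents_lt_size 0 s; rewrite asc_s; lia.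
have bad x : ~~ good (0 :: rcons s x) -> extensions N n (0 :: rcons s x) = 0.
  exact: extensions_bad.
rewrite extensionsS; under eq_bigr => x _ do rewrite rcons_cons.
move: (maximum (0 :: s)) gx mx ax sx ltN bad m_gt0 last_s => m.
move=> gx mx ax sx ltN bad m_gt0 last_s {asc_s gs leN}.
case: z last_s => last_s; rewrite last_s in gx ax.
(* After a 0, the admissible letters are [m + d] with [d <= k.+1]. Each makes an ascent and raises
   the maximum by [d], leaving slack [k.+1 - d]. *)
- apply: (sum_up_to m k.+1 N _ (fun j => walks n j false)) => // [d led|x ltxN xout].
    apply: IHn; rewrite ?gx ?mx ?ax ?last_rcons //; lia.
  by apply: bad; rewrite gx; lia.
(* After the maximum [m], the letters 0 and [m] make no ascent and keep the slack [k]; they are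
   split off first. A letter [m.+1 + d] with [d <= k] makes an ascent and leaves slack [k - d]. *)
- rewrite (bigD1_seq 0) ?mem_index_iota ?iota_uniq //=; last by lia.
  rewrite big_mkcond.
  rewrite (bigD1_seq m) ?mem_index_iota ?iota_uniq //=; last by lia.
  rewrite -lt0n m_gt0 addnA; congr (_ + _ + _).
  + apply: IHn; rewrite ?gx ?mx ?ax ?last_rcons //; lia.
  + apply: IHn; rewrite ?gx ?mx ?ax ?last_rcons //; lia.
  rewrite big_mkcond; apply: (sum_up_to m.+1 k N _ (fun j => walks n j false)) => [|d led|x ltxN xout].
  + lia.
  + rewrite ifT ?ifT; try lia.
    apply: IHn; rewrite ?gx ?mx ?ax ?last_rcons //; lia.
  + case: ifP => // xm; case: ifP => // x0; apply: bad; rewrite gx; lia.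
Qed.

Lemma u_walks (n : nat) : u n.+2 = walks n 0 false.
Proof.
have sum_single (y : nat) (F : nat -> nat) : y < n.+2 ->
    (forall x, x != y -> F x = 0) -> \sum_(0 <= x < n.+2) F x = F y.
  move=> lty F0; rewrite (bigD1_seq y) ?mem_index_iota ?iota_uniq //=.
  by rewrite big1 ?addn0.
rewrite u_extensions extensionsS (sum_single 0) //; last first.
  by move=> x x0; apply: extensions_bad; rewrite good_seq1.
rewrite extensionsS (sum_single 1) //; last first.
  move=> x x1; apply: extensions_bad; rewrite good_rcons good_seq1 /=.
  have -> : ascents [:: 0] = 0 by [].
  by case: x x1 => [|[|x]].
by apply: extensions_walks; rewrite // (good_rcons [::]) good_seq1.
Qed.

(** * Convolutions as products of generating functions *)

Definition convolution (a b : nat -> nat) (n : nat) : nat :=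
  \sum_(i < n.+1) a i * b (n - i).

Lemma eq_convolution (a b a' b' : nat -> nat) (n : nat) :
  (forall i, i <= n -> a i = a' i) -> (forall i, i <= n -> b i = b' i) ->
  convolution a b n = convolution a' b' n.
Proof.
move=> eqa eqb; apply: eq_bigr => i _; rewrite eqa ?eqb ?leq_subr //.
by rewrite -ltnS.
Qed.

Lemma convolutionDl (a a' b : nat -> nat) (n : nat) :
  convolution (fun i => a i + a' i) b n = convolution a b n + convolution a' b n.
Proof. by rewrite -big_split; apply: eq_bigr => i _; rewrite mulnDl. Qed.

Lemma convolutionDr (a b b' : nat -> nat) (n : nat) :
  convolution a (fun i => b i + b' i) n = convolution a b n + convolution a b' n.
Proof. by rewrite -big_split; apply: eq_bigr => i _; rewrite mulnDr. Qed.

Lemma convolutionSl (a b : nat -> nat) (n : nat) :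
  convolution a b n.+1 = a 0 * b n.+1 + convolution (fun i => a i.+1) b n.
Proof. by rewrite /convolution big_ord_recl. Qed.

Lemma convolutionSr (a b : nat -> nat) (n : nat) :
  convolution a b n.+1 = convolution a (fun i => b i.+1) n + a n.+1 * b 0.
Proof.
rewrite /convolution big_ord_recr subnn /=; congr (_ + _).
by apply: eq_bigr => i _; rewrite subSn // -ltnS.
Qed.

Lemma convolution0 (a b : nat -> nat) : convolution a b 0 = a 0 * b 0.
Proof. by rewrite /convolution big_ord1. Qed.

(** Truncating both series at degree [N] does not affect the coefficient of degree [n]. This
    transfers associativity from polynomial multiplication. *)
Lemma convolution_coef (a b : nat -> nat) (n N : nat) : n < N ->
  convolution a b n = ((\poly_(i < N) a i * \poly_(i < N) b i)`_n)%R.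
Proof.
move=> ltnN; rewrite coefM; apply: eq_bigr => i _; rewrite !coef_poly.
by rewrite !ifT //; have := ltn_ord i; lia.
Qed.

Lemma convolutionA (a b c : nat -> nat) (n : nat) :
  convolution (convolution a b) c n = convolution a (convolution b c) n.
Proof.
transitivity (((\poly_(i < n.+1) a i * \poly_(i < n.+1) b i *
               \poly_(i < n.+1) c i)`_n)%R).
  rewrite coefM; apply: eq_bigr => i _.
  rewrite (@convolution_coef _ _ _ n.+1) // coef_poly ifT //.
  by rewrite ltnS leq_subr.
rewrite -GRing.mulrA coefM; apply: eq_bigr => i _.
rewrite (@convolution_coef _ _ _ n.+1) ?ltnS ?leq_subr // coef_poly ifT //.
Qed.

(** * The recurrence in the slack *)

Definition walks_pos (k n : nat) : nat := walks n k false.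

(** The coefficients of x A B, where A and B are the generating functions of [a] and [b]. *)
Definition shifted_convolution (a b : nat -> nat) (n : nat) : nat :=
  if n is n'.+1 then convolution a b n' else 0.

Lemma shifted_convolutionA (a b c : nat -> nat) (n : nat) :
  convolution (shifted_convolution a b) c n =
  convolution a (shifted_convolution b c) n.
Proof.
case: n => [|n]; first by rewrite !convolution0 muln0.
by rewrite convolutionSl convolutionSr /= mul0n muln0 addn0 convolutionA.
Qed.

Lemma walks_pos0 (k : nat) : walks_pos k 0 = 1.
Proof. by []. Qed.

Lemma walks_pos1 (k : nat) : walks_pos k 1 = k.+3.
Proof. by rewrite /walks_pos /= sum1_card card_ord. Qed.

Lemma walks_posSS (k n : nat) :
  walks_pos k n.+2 = \sum_(j < k.+2) walks_pos j n + walks_pos k n.+1 +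
                     \sum_(j < k.+1) walks_pos j n.+1.
Proof. by []. Qed.

(* Coefficientwise, A_(k+1) = A_k + x A_0 A_k. By strong induction on [n]: the
   recurrence for A_0 expands the product A_0 A_k, and the leftover is
   A_1 A_k = A_0 A_(k+1), which follows from the lower coefficients and
   associativity. *)
Lemma walks_posS (k n : nat) :
  walks_pos k.+1 n =
  walks_pos k n + shifted_convolution (walks_pos 0) (walks_pos k) n.
Proof.
have [N] := ubnP n; elim: N n k => // N IHN [|[|m]] k ltnN.
- by [].
- by rewrite /= convolution0 !walks_pos1 !walks_pos0 !addn1.
have IH j i : i <= m.+1 -> walks_pos j.+1 i =
    walks_pos j i + shifted_convolution (walks_pos 0) (walks_pos j) i.
  by move=> lei; apply: IHN; lia.
rewrite !walks_posSS big_ord_recr [X in _ + X]big_ord_recr /=.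
(* Subtracting the rule for slack [k] from the rule for [k.+1] leaves the top terms of the two sums
   and a difference of middle terms, which [IH] evaluates. *)
suff -> : convolution (walks_pos 0) (walks_pos k) m.+1 =
    walks_pos k.+2 m + shifted_convolution (walks_pos 0) (walks_pos k) m.+1 +
    walks_pos k.+1 m.+1.
  by have := IH k m.+1 (leqnn _); lia.
have -> : walks_pos k.+2 m = walks_pos k m +
    shifted_convolution (walks_pos 0) (walks_pos k) m +
    shifted_convolution (walks_pos 0) (walks_pos k.+1) m.
  by rewrite !IH // ltnW.
rewrite (IH k) // convolutionSl walks_pos0 mul1n.
(* [z i] is the value of [walks i 0 true], so [z_rec] is the transition rule at slack 0 and holds
   from [i = 0] on. *)
pose z i := if i is i'.+1 then walks_pos 0 i' + walks_pos 1 i' else 1.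
have z_rec i : walks_pos 0 i.+1 = walks_pos 0 i + walks_pos 0 i + z i.
  case: i => [|i]; first by rewrite walks_pos1.
  by rewrite walks_posSS big_ord_recr !big_ord1 /z /=; lia.
rewrite (eq_convolution (fun i => walks_pos 0 i.+1) (walks_pos k)
  (fun i => walks_pos 0 i + walks_pos 0 i + z i) (walks_pos k)) //.
rewrite !convolutionDl [shifted_convolution _ _ m.+1]/=.
suff -> : convolution z (walks_pos k) m = walks_pos k m +
    shifted_convolution (walks_pos 0) (walks_pos k) m +
    shifted_convolution (walks_pos 0) (walks_pos k.+1) m by lia.
case: m IH {ltnN} => [|p] IH; first by rewrite convolution0 /= mul1n !addn0.
rewrite convolutionSl mul1n convolutionDl /= -addnA; congr (_ + (_ + _)).
rewrite (eq_convolution (walks_pos 1) (walks_pos k) (fun i => walks_pos 0 i +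
  shifted_convolution (walks_pos 0) (walks_pos 0) i) (walks_pos k)) //; last first.
  by move=> i lei; apply: IH; lia.
rewrite (eq_convolution (walks_pos 0) (walks_pos k.+1) (walks_pos 0)
  (fun i => walks_pos k i +
            shifted_convolution (walks_pos 0) (walks_pos k) i)) //; last first.
  by move=> i lei; apply: IH; lia.
by rewrite convolutionDl convolutionDr shifted_convolutionA.
Qed.

(** * Initial values and the quadratic recurrence *)

Lemma u0 : u 0 = 1.
Proof. by rewrite u_extensions extensions0 good_nil. Qed.

Lemma u1 : u 1 = 1.
Proof. by rewrite u_extensions extensionsS big_nat1 extensions0 good_seq1. Qed.

Lemma u2 : u 2 = 1.
Proof. by rewrite u_walks. Qed.

Theorem theorem5 :
  [/\ u 0 = 1, u 1 = 1, u 2 = 1 &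
      forall n : nat, 3 <= n -> u n = \sum_(i < n) u i * u (n - 1 - i)].
Proof.
split; [exact: u0 | exact: u1 | exact: u2 | case=> [|[|[|m]]] // _].
have -> : \sum_(i < m.+3) u i * u (m.+3 - 1 - i) = convolution u u m.+2.
  by rewrite subn1.
(* Since [u_walks] applies only from index 2 on, the terms with a factor [u 0] or [u 1] are split
   off at both ends, with the shortest sums treated separately. *)
rewrite convolutionSl convolutionSr u0 u_walks muln1 mul1n.
case: m => [|m].
  by rewrite convolution0 u1 u2 -[walks _ _ _]/(walks_pos 0 1) walks_pos1.
rewrite convolutionSl u1 mul1n !u_walks -!/(walks_pos 0 _).
(* The rule for A_0 involves A_1 = A_0 + x A_0^2. Its quadratic part matches the products in which
   both indices of [u] are at least 2. *)
rewrite walks_posSS big_ord_recr !big_ord1 /= walks_posS.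
case: m => [|m].
  by rewrite convolution0 u2 u1 walks_pos1 walks_pos0.
rewrite convolutionSr u1 muln1 u_walks -/(walks_pos 0 _).
rewrite (eq_convolution (fun i => u i.+2) (fun i => u i.+2)
  (walks_pos 0) (walks_pos 0)) /=; try by move=> i _; exact: u_walks.
by lia.
Qed.
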